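(* The modal logic $\mathsf{K4}$ is sound for provability models with necessitation, and it is also sound for transitive provability models. That is, if $\mathsf{K4}\vdash A$ and $\mathcal P$ is a provability model which either has necessitation or has a transitive accessibility relation, then $\mathcal P,w\Vdash A$ for every world $w$ of $\mathcal P$.
   Context: $\mathsf{K4}$ is $\mathsf K$ (the smallest normal modal logic) plus the axiom $\Box A\to\Box\Box A$. Language $\mathcal L_\Box$: formulas built from atomic propositions and $\bot$ using $\to$ and a unary $\Box$. A formula is purely modal if it is a Boolean combination of formulas of the form $\Box B$. A theory is a pair of a set of axioms and a set of inference rules (finitely many premises, one conclusion); $\mathsf T\vdash A$ means derivability from axioms by rules. A theory is classical if modus ponens is one of its rules and all classical tautologies are derivable. A provability pre-model is $\mathcal P=(W,\sqsubset,\{L_w\}_{w\in W^\sqsubset},V)$ with $W$ nonempty, $\sqsubset$ a binary relation on $W$, $V\subseteq W\times\mathrm{atoms}$, $W^\sqsubset=\{u:\exists v\,(v\sqsubset u)\}$, and a theory $L_w$ for each $w\in W^\sqsubset$. Satisfaction: atoms via $V$, $\bot$ never holds, $\to$ classical, $\mathcal P,w\Vdash\Box A$ iff $L_u\vdash A$ for all $u$ with $w\sqsubset u$. With $\sqsubset^+$ the transitive closure, $\mathcal P,w\Vdash^+A$ iff there is $u\sqsubset w$ with $\mathcal P,v\Vdash A$ for all $v$ such that $u\sqsubset^+v$. A provability model is a pre-model in which every $L_w$ is classical and which satisfies modal completeness: for every $w\in W^\sqsubset$ and purely modal $A$, $\mathcal P,w\Vdash^+A$ implies $L_w\vdash A$.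 A provability model has necessitation if every $L_w$ has the rule ''from $A$ infer $\Box A$'' among its rules; it is transitive if $\sqsubset$ is transitive. *)

(* Defs.v *)
From Stdlib Require Import List Bool Relations.
Import ListNotations.

Set Implicit Arguments.
Unset Strict Implicit.

Section Syntax.

Variable atom : Type.

Inductive form : Type :=
| Var (p : atom)
| Bot
| Imp (A B : form)
| Box (A : form).

(* The primitive connectives [Bot] and [Imp] generate all Boolean ones. *)
Inductive purely_modal : form -> Prop :=
| pm_box B : purely_modal (Box B)
| pm_bot : purely_modal Bot
| pm_imp A B : purely_modal A -> purely_modal B -> purely_modal (Imp A B).

Fixpoint beval (v : form -> bool) (A : form) : bool :=
  match A with
  | Var _ | Box _ => v A
  | Bot => false
  | Imp B C => implb (beval v B) (beval v C)
  end.

(* Tautologies of the modal language: boxed formulas are evaluated as atoms. *)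
Definition tautology (A : form) : Prop := forall v, beval v A = true.

(* A rule is the set of its instances, each with a finite list of premises. *)
Definition rule : Type := list form -> form -> Prop.

Record theory : Type := Theory {
  axioms : form -> Prop;
  rules : rule -> Prop
}.

Inductive derives (T : theory) : form -> Prop :=
| derives_axiom A : axioms T A -> derives T A
| derives_rule (r : rule) (prems : list form) (C : form) :
    rules T r -> r prems C ->
    (forall B, In B prems -> derives T B) -> derives T C.

Definition modus_ponens : rule :=
  fun prems C => exists A, prems = [A; Imp A C].

Definition necessitation : rule :=
  fun prems C => exists A, prems = [A] /\ C = Box A.

Definition classical (T : theory) : Prop :=
  rules T modus_ponens /\ (forall A, tautology A -> derives T A).

Definition axiom_K (C : form) : Prop :=
  exists A B, C = Imp (Box (Imp A B)) (Imp (Box A) (Box B)).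

Definition axiom_4 (C : form) : Prop :=
  exists A, C = Imp (Box A) (Box (Box A)).

Definition add_axioms (T : theory) (X : form -> Prop) : theory :=
  Theory (fun A => axioms T A \/ X A) (rules T).

Definition K : theory :=
  Theory (fun A => tautology A \/ axiom_K A)
         (fun r => r = modus_ponens \/ r = necessitation).

Definition K4 : theory := add_axioms K axiom_4.

Fixpoint subst (s : atom -> form) (A : form) : form :=
  match A with
  | Var p => s p
  | Bot => Bot
  | Imp B C => Imp (subst s B) (subst s C)
  | Box B => Box (subst s B)
  end.

Record normal_logic (X : form -> Prop) : Prop := {
  normal_taut : forall A, tautology A -> X A;
  normal_K : forall A, axiom_K A -> X A;
  normal_mp : forall A B, X A -> X (Imp A B) -> X B;
  normal_nec : forall A, X A -> X (Box A);
  normal_subst : forall s A, X A -> X (subst s A)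
}.

Lemma beval_subst v s A :
  beval v (subst s A) = beval (fun B => beval v (subst s B)) A.
Proof. induction A; simpl; congruence. Qed.

Lemma tautology_subst s A : tautology A -> tautology (subst s A).
Proof. intros H v; rewrite beval_subst; apply H. Qed.

Lemma derives_mp T A B :
  rules T modus_ponens -> derives T A -> derives T (Imp A B) -> derives T B.
Proof.
intros Hr HA HAB.
apply derives_rule with (r := modus_ponens) (prems := [A; Imp A B]); trivial.
- now exists A.
- intros C [<- | [<- | []]]; trivial.
Qed.

Lemma derives_nec T A :
  rules T necessitation -> derives T A -> derives T (Box A).
Proof.
intros Hr HA.
apply derives_rule with (r := necessitation) (prems := [A]); trivial.
- now exists A.
- intros C [<- | []]; trivial.
Qed.

Lemma derives_K_extension (X Y : form -> Prop) :
  normal_logic Y -> (forall A, X A -> Y A) ->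
  forall A, derives (add_axioms K X) A -> Y A.
Proof.
intros HY HX A HA; induction HA as [A HA | r ps C Hr HC _ IH].
- destruct HA as [[H | H] | H].
  + now apply (normal_taut HY).
  + now apply (normal_K HY).
  + now apply HX.
- destruct Hr as [-> | ->].
  + destruct HC as [A ->].
    apply (normal_mp HY (A := A)); apply IH; simpl; auto.
  + destruct HC as [A [-> ->]].
    apply (normal_nec HY); apply IH; simpl; auto.
Qed.

Lemma normal_K_extension (X : form -> Prop) :
  (forall s A, X A -> X (subst s A)) -> normal_logic (derives (add_axioms K X)).
Proof.
intros HX; constructor.
- intros A H; apply derives_axiom; left; now left.
- intros A H; apply derives_axiom; left; now right.
- intros A B; apply derives_mp; now left.
- intros A; apply derives_nec; now right.
- intros s A HA; induction HA as [A HA | r ps C Hr HC _ IH].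
  + apply derives_axiom; destruct HA as [[H | [B [C ->]]] | H].
    * left; left; now apply tautology_subst.
    * left; right; simpl; now eexists; eexists.
    * right; now apply HX.
  + destruct Hr as [-> | ->].
    * destruct HC as [A ->].
      apply derives_mp with (A := subst s A); [now left | |].
      -- apply IH; simpl; auto.
      -- apply (IH (Imp A C)); simpl; auto.
    * destruct HC as [A [-> ->]]; simpl.
      apply derives_nec; [now right | apply IH; simpl; auto].
Qed.

Lemma K_smallest_normal :
  normal_logic (derives K) /\
  (forall Y, normal_logic Y -> forall A, derives K A -> Y A).
Proof.
assert (E : forall A, derives K A <-> derives (add_axioms K (fun _ => False)) A).
{ intros A; split; intros H; induction H as [A H | r ps C Hr HC _ IH];
    try (now apply derives_rule with (r := r) (prems := ps));
    apply derives_axiom; simpl in *; tauto. }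
destruct (@normal_K_extension (fun _ => False)) as [h1 h2 h3 h4 h5]; [tauto |].
split.
- constructor.
  + intros A H; now apply E, h1.
  + intros A H; now apply E, h2.
  + intros A B H1 H2; apply E, (h3 A); now apply E.
  + intros A H; apply E, h4; now apply E.
  + intros s A H; apply E, h5; now apply E.
- intros Y HY A HA.
  apply (@derives_K_extension (fun _ => False) Y); trivial; [tauto | now apply E].
Qed.

Lemma K4_smallest_normal :
  (normal_logic (derives K4) /\ (forall A, axiom_4 A -> derives K4 A)) /\
  (forall Y, normal_logic Y -> (forall A, axiom_4 A -> Y A) ->
     forall A, derives K4 A -> Y A).
Proof.
split; [split |].
- apply normal_K_extension; intros s A [B ->]; now exists (subst s B).
- intros A H; apply derives_axiom; now right.
- intros Y HY H4; now apply derives_K_extension.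
Qed.

End Syntax.

Arguments Bot {atom}.
Arguments K {atom}.
Arguments K4 {atom}.
Arguments modus_ponens {atom}.
Arguments necessitation {atom}.

(* [pm_theory] is defined exactly on the worlds with a predecessor. *)
Record premodel (atom : Type) : Type := Premodel {
  world : Type;
  world_nonempty : inhabited world;
  acc : world -> world -> Prop;
  pm_theory : forall w : world, (exists v, acc v w) -> theory atom;
  val : world -> atom -> Prop
}.

Arguments world {atom} p.
Arguments acc {atom p}.
Arguments pm_theory {atom p} w.
Arguments val {atom p}.

Section Semantics.

Variable atom : Type.
Variable P : premodel atom.

Fixpoint sat (w : world P) (A : form atom) : Prop :=
  match A with
  | Var p => val w p
  | Bot => False
  | Imp B C => sat w B -> sat w C
  | Box B =>
      forall (u : world P) (wu : acc w u),
        derives (pm_theory u (ex_intro (fun v => acc v u) w wu)) B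
  end.

Definition sat_plus (w : world P) (A : form atom) : Prop :=
  exists u, acc u w /\ forall v, clos_trans (world P) acc u v -> sat v A.

Definition modally_complete : Prop :=
  forall (w : world P) (hw : exists v, acc v w) (A : form atom),
    purely_modal A -> sat_plus w A -> derives (pm_theory w hw) A.

Definition provability_model : Prop :=
  (forall (w : world P) (hw : exists v, acc v w), classical (pm_theory w hw)) /\
  modally_complete.

Definition has_necessitation : Prop :=
  forall (w : world P) (hw : exists v, acc v w),
    rules (pm_theory w hw) necessitation.

Definition is_transitive : Prop := transitive (world P) acc.

End Semantics.

Arguments sat {atom} P w A.

(* Main.v *)
(** The set of formulas that are true at every world and provable in every
    theory [L_w] contains the axioms of K4 and is closed under modus ponens and
    necessitation.  The point is that a purely modal formula true everywhere is
    provable everywhere by modal completeness, which covers the axioms K and 4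
    and the conclusions of necessitation.  The truth of axiom 4 uses the extra
    hypothesis: necessitation passes from [L_u |- A] to [L_u |- Box A]
    directly; under transitivity, if [Box A] holds at [w] then it holds at all
    worlds above [w], so modal completeness gives [L_u |- Box A]. *)

From Stdlib Require Import List Bool Relations ClassicalEpsilon Classical_Prop.
Require Import Defs.

Section Soundness.

Variables (atom : Type) (P : premodel atom).

(** Excluded middle turns truth at [w] into a boolean valuation of atoms and boxes, the kind
    quantified over in [tautology]. *)
Lemma beval_sat (w : world P) (A : form atom) :
  beval (fun B => if excluded_middle_informative (sat P w B)
                  then true else false) A = true <-> sat P w A.
Proof.
  induction A as [p | | A IHA B IHB | A IHA]; cbn [beval].
  - destruct excluded_middle_informative; intuition congruence.
  - cbn; intuition congruence.
  - cbn [sat]; rewrite implb_true_iff; tauto.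
  - destruct excluded_middle_informative; intuition congruence.
Qed.

Lemma sat_tautology (w : world P) (A : form atom) :
  tautology A -> sat P w A.
Proof. intros HA; apply beval_sat, HA. Qed.

Hypothesis HP : provability_model P.

Lemma derives_valid_purely_modal (A : form atom) :
  purely_modal A -> (forall w, sat P w A) ->
  forall (w : world P) (hw : exists v, acc v w), derives (pm_theory w hw) A.
Proof.
  intros HA Hsat w hw.
  destruct HP as [_ complete]; apply complete; trivial.
  destruct hw as [u uw]; exists u; auto.
Qed.

Lemma sat_axiom_K (w : world P) (A B : form atom) :
  sat P w (Imp (Box (Imp A B)) (Imp (Box A) (Box B))).
Proof.
  intros HAB HA u wu.
  destruct HP as [cl _].
  apply (derives_mp (A := A)); auto.
  apply cl.
Qed.

Lemma sat_box_acc (w v : world P) (A : form atom) :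
  is_transitive P -> acc w v -> sat P w (Box A) -> sat P v (Box A).
Proof.
  intros tr wv HA u vu.
  (* The theory at [u] is indexed by a proof that [u] has a predecessor; the witness [v] is swapped
     for [w]. *)
  rewrite (proof_irrelevance _ _ (ex_intro _ w (tr _ _ _ wv vu))).
  apply HA.
Qed.

Lemma sat_axiom_4 (w : world P) (A : form atom) :
  has_necessitation P \/ is_transitive P ->
  sat P w (Imp (Box A) (Box (Box A))).
Proof.
  intros [nec | tr] HA u wu.
  - apply derives_nec; [apply nec | apply HA].
  - destruct HP as [_ complete]; apply complete; [constructor |].
    exists w; split; trivial.
    intros v wv; apply sat_box_acc with w; trivial.
    (* Transitivity collapses [clos_trans] to [acc]. *)
    clear -tr wv; induction wv as [| x y z _ xy _ yz]; trivial.
    now apply tr with y.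
Qed.

(** Both halves go through one induction: truth of [Box B] rests on derivability of [B]. *)
Lemma K4_sat_and_derives (A : form atom) :
  has_necessitation P \/ is_transitive P -> derives K4 A ->
  (forall w, sat P w A) /\
  (forall (w : world P) (hw : exists v, acc v w), derives (pm_theory w hw) A).
Proof.
  intros HN HA.
  assert (modal : forall B, purely_modal B -> (forall w, sat P w B) ->
    (forall w, sat P w B) /\
    (forall (w : world P) (hw : exists v, acc v w), derives (pm_theory w hw) B))
    by (split; trivial; now apply derives_valid_purely_modal).
  induction HA as [A HA | r prems C Hr HC _ IH].
  - destruct HA as [[HA | [B [C ->]]] | [B ->]].
    + split; [intros w; now apply sat_tautology |].
      intros w hw; destruct HP as [cl _]; now apply cl.
    + apply modal; [repeat constructor | intros w; apply sat_axiom_K].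
    + apply modal; [repeat constructor | intros w; now apply sat_axiom_4].
  - destruct Hr as [-> | ->].
    + destruct HC as [B ->].
      destruct (IH B) as [sB dB]; [simpl; auto |].
      destruct (IH (Imp B C)) as [sBC dBC]; [simpl; auto |].
      split; [intros w; apply sBC, sB |].
      intros w hw; apply (derives_mp (A := B)); auto.
      destruct HP as [cl _]; apply cl.
    + destruct HC as [B [-> ->]].
      destruct (IH B) as [_ dB]; [simpl; auto |].
      apply modal; [constructor | intros w u wu; apply dB].
Qed.

End Soundness.

Theorem theorem3p8 (atom : Type) (A : form atom) (P : premodel atom) :
  derives K4 A ->
  provability_model P ->
  has_necessitation P \/ is_transitive P ->
  forall w : world P, sat P w A.
Proof.
  intros HA HP HN.
  now apply K4_sat_and_derives.
Qed.
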